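(* Let $A^{\mathbf{R}}_k \subset V_k$ be the set of elements of the integral shuffle algebra in $k$ variables. Then the following hold: (a) For every $k$, $A^{\mathbf{R}}_k$ is a module over $V_k = \mathbf{R}[z_1^{\pm 1},\dots,z_k^{\pm 1}]^{S_k}$, with $V_k$ acting by ordinary multiplication (that is, $A^{\mathbf{R}}_k$ is a $V_k$-submodule of $V_k$). (b) As a $V_2$-module, $A^{\mathbf{R}}_2$ is generated by $z_1 * z_1^0$ and $z_1^0 * z_1^0$. (c) As a $V_3$-module, $A^{\mathbf{R}}_3$ is generated by the six elements $z_1^{d_1} * z_1^{d_2} * z_1^0$ with $d_1,d_2$ integers, $0 \le d_1 \le 2$, $0 \le d_2 \le 1$.
   Context: Let $\mathbf{R} = \mathbb{C}[q_1^{\pm 1}, q_2^{\pm 1}]$ and $q = q_1 q_2$. Let $V_k = \mathbf{R}[z_1^{\pm 1},\dots,z_k^{\pm 1}]^{S_k}$ be the ring of symmetric Laurent polynomials in $z_1,\dots,z_k$ over $\mathbf{R}$ (with its ordinary multiplication), and $V = \bigoplus_{k\ge 0} V_k$. The shuffle product $* : V_k \times V_l \to V_{k+l}$ is $$(P*Q)(z_1,\dots,z_{k+l}) = \frac{1}{k!\,l!}\,\mathrm{Sym}\Big[P(z_1,\dots,z_k)\,Q(z_{k+1},\dots,z_{k+l}) \prod_{1\le i\le k<j\le k+l} \omega(z_i,z_j)\Big],$$ where $\mathrm{Sym}(F(z_1,\dots,z_m)) = \sum_{\sigma\in S_m} F(z_{\sigma(1)},\dots,z_{\sigma(m)})$ and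 $$\omega(z_i,z_j) = \frac{(z_i - q z_j)(z_j - q_1 z_i)(z_j - q_2 z_i)}{z_i - z_j}.$$ The shuffle product is associative. The integral shuffle algebra $A^{\mathbf{R}} \subset V$ is the $\mathbf{R}$-algebra generated, under the product $*$, by the elements $z_1^d \in V_1$, $d\in\mathbb{Z}$; and $A^{\mathbf{R}}_k = A^{\mathbf{R}} \cap V_k$. In the expressions $z_1^{d_1} * z_1^{d_2} * \cdots$, each factor $z_1^{d_i}$ is regarded as an element of $V_1$; $z_1^0$ denotes the element $1 \in V_1$. *)

(* Defs.v *)
From HB Require Import structures.
From mathcomp Require Import all_boot all_order all_algebra.
From mathcomp Require Import perm generic_quotient.
From mathcomp Require Import complex reals.
From mathcomp Require Import mpoly.

Set Implicit Arguments.
Unset Strict Implicit.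
Unset Printing Implicit Defensive.

Import GRing.Theory.
Local Open Scope ring_scope.
Local Open Scope quotient_scope.

(* [laurent S x f]: f is a Laurent polynomial in x_0, ..., x_(n-1) with
   coefficients in S. *)
Definition laurent (L : fieldType) (n : nat) (S : L -> Prop) (x : 'I_n -> L)
    (f : L) : Prop :=
  exists2 s : seq (L * {ffun 'I_n -> int}),
    {in s, forall t, S t.1} &
    f = \sum_(t <- s) t.1 * \prod_(i < n) x i ^ t.2 i.

(* The field C(q_1, q_2), for C = complex RR. *)
Definition Cq (RR : realType) : fieldType := {fraction {mpoly (complex RR)[2]}}.

Definition Cconst (RR : realType) (c : complex RR) : Cq RR :=
  FracField.tofrac c%:MP_[2].
Definition qvar (RR : realType) (i : 'I_2) : Cq RR := FracField.tofrac 'X_i.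
Definition q1 (RR : realType) : Cq RR := qvar RR ord0.
Definition q2 (RR : realType) : Cq RR := qvar RR ord_max.

(* The ring C[q_1^{+-1}, q_2^{+-1}], inside C(q_1, q_2). *)
Definition Rq (RR : realType) : Cq RR -> Prop :=
  laurent (fun a => exists c : complex RR, a = Cconst c) (qvar RR).

(* The field C(q_1, q_2)(z_0, ..., z_(k-1)), in which all Laurent polynomials
   and the rational function omega live. *)
Definition Kz (RR : realType) (k : nat) : fieldType :=
  {fraction {mpoly (Cq RR)[k]}}.

Definition scal (RR : realType) (k : nat) (a : Cq RR) : Kz RR k :=
  FracField.tofrac a%:MP_[k].
HB.instance Definition _ (RR : realType) (k : nat) :=
  GRing.RMorphism.copy (@scal RR k)
    (@FracField.tofrac {mpoly (Cq RR)[k]} \o @mpolyC k (Cq RR)).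

Definition zvar (RR : realType) (k : nat) (i : 'I_k) : Kz RR k :=
  FracField.tofrac 'X_i.

(* [subst f v] is f(v_0, ..., v_(k-1)). It is only applied to tuples v of
   pairwise distinct variables, at which no nonzero polynomial vanishes, so the
   value does not depend on the chosen representative of the fraction f. *)
Definition subst (RR : realType) (k n : nat) (f : Kz RR k)
    (v : 'I_k -> Kz RR n) : Kz RR n :=
  mmap (@scal RR n) v \n_(repr f) / mmap (@scal RR n) v \d_(repr f).

Definition Symz (RR : realType) (k : nat) (f : Kz RR k) : Kz RR k :=
  \sum_(s : 'S_k) subst f (fun i => zvar RR (s i)).

(* The ring V_k, inside the field of rational functions. *)
Definition Vz (RR : realType) (k : nat) (f : Kz RR k) : Prop :=
  laurent (fun a => exists2 r : Cq RR, Rq r & a = scal k r) (@zvar RR k) f /\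
  forall s : 'S_k, subst f (fun i => zvar RR (s i)) = f.

Definition omega (RR : realType) (k : nat) (i j : 'I_k) : Kz RR k :=
  let z := @zvar RR k in
  let a1 := scal k (q1 RR) in
  let a2 := scal k (q2 RR) in
  (z i - a1 * a2 * z j) * (z j - a1 * z i) * (z j - a2 * z i) / (z i - z j).

Definition shuffle (RR : realType) (k l : nat) (P : Kz RR k) (Q : Kz RR l) :
    Kz RR (k + l) :=
  (k`! * l`!)%:R^-1 *
  Symz (subst P (fun i => zvar RR (lshift l i)) *
        subst Q (fun j => zvar RR (rshift k j)) *
        \prod_(i < k) \prod_(j < l) omega RR (lshift l i) (rshift k j)).

(* Graded families; those with components in V_k and finite support form
   V = \bigoplus_k V_k. *)
Definition graded (RR : realType) : Type := forall k : nat, Kz RR k.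

Definition in_V (RR : realType) (f : graded RR) : Prop :=
  (forall k, Vz (f k)) /\ (exists N, forall k, (N <= k)%N -> f k = 0).

Definition in_degree (RR : realType) (k : nat) (P : Kz RR k) : graded RR :=
  fun n => match @eqP _ k n with
           | ReflectT e => ecast m (Kz RR m) e P
           | ReflectF _ => 0
           end.

(* The product of degree-n components: the sum over i + j = n of f_i * g_j,
   transported along i + (n - i) = n. *)
Definition shuffle_graded (RR : realType) (f g : graded RR) : graded RR :=
  fun n => \sum_(i < n.+1)
    ecast m (Kz RR m) (subnKC (leq_ord i)) (shuffle (f i) (g (n - i)%N)).

(* z_1^d, as an element of V_1. *)
Definition zpow (RR : realType) (d : int) : Kz RR 1 := zvar RR (ord0 : 'I_1) ^ d.

Inductive shuffle_gen (RR : realType) : graded RR -> Prop :=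
| gen_zpow (d : int) : shuffle_gen (in_degree (zpow RR d))
| gen_one : shuffle_gen (in_degree (1 : Kz RR 0))
| gen_add (f g : graded RR) :
    shuffle_gen f -> shuffle_gen g -> shuffle_gen (fun k => f k + g k)
| gen_scale (r : Cq RR) (f : graded RR) :
    Rq r -> shuffle_gen f -> shuffle_gen (fun k => scal k r * f k)
| gen_shuffle (f g : graded RR) :
    shuffle_gen f -> shuffle_gen g -> shuffle_gen (shuffle_graded f g).

(* The integral shuffle algebra A^R, as a subset of V, and its intersection with
   V_k. The generators lie in V and the shuffle product preserves V, so in_V
   excludes nothing from shuffle_gen. *)
Definition AR (RR : realType) (f : graded RR) : Prop := in_V f /\ shuffle_gen f.
Definition ARk (RR : realType) (k : nat) (P : Kz RR k) : Prop :=
  Vz P /\ AR (in_degree P).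

Definition Vz_submodule (RR : realType) (k : nat) (S : Kz RR k -> Prop) : Prop :=
  [/\ forall P, S P -> Vz P,
      S 0,
      forall P Q, S P -> S Q -> S (P + Q) &
      forall f P, Vz f -> S P -> S (f * P)].

(* S is the V_k-submodule generated by the finite family g. *)
Definition Vz_generated_by (RR : realType) (k : nat) (S : Kz RR k -> Prop)
    (I : finType) (g : I -> Kz RR k) : Prop :=
  forall P, S P <->
    exists2 c : I -> Kz RR k, forall i, Vz (c i) & P = \sum_i c i * g i.

(* Main.v *)
From HB Require Import structures.
Require Import Defs.
From mathcomp Require Import all_boot all_order all_algebra.
From mathcomp Require Import fingroup perm generic_quotient.
From mathcomp Require Import complex boolp reals mpoly ring.

(** Write Omega_k for the product of omega(z_i, z_j) over i < j. The factor
    omega(z_i, z_j), taken over i <= k < j, is invariant as a whole under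
    S_k x S_l, so shuffling Sym[g Omega_k] with Sym[h Omega_l] sums k! l! terms
    that become equal under Sym, and gives Sym[g h' Omega_(k+l)], where h' is h in the last l variables
    ([shuffle_omegas]). Hence the integral shuffle algebra in degree k is the
    set of all Sym[g Omega_k] with g a Laurent polynomial: this set contains
    the generators and is stable under the operations ([shuffle_gen_omega_sym]),
    and conversely Sym[z^d Omega_k] is the product of the one-variable monomials
    z_1^(d_i) ([gen_degree_omega_sym]). Symmetrization is linear over symmetric
    functions, f Sym[g Omega_k] = Sym[f g Omega_k], and this is part (a).

    For generators it is then enough to span the Laurent polynomials over the
    symmetric ones: if finitely many monomials m_b do so, the elements
    Sym[m_b Omega_k] generate ([ARk_generated]). In two variables 1 and z_1 span,
    because z_1 is a root of the polynomial with roots z_1, z_2; in three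
    variables z_1^a z_2^b with a <= 2, b <= 1 span, because z_1 is a root of a
    symmetric cubic and z_2 is then a root of the quotient of that cubic by
    T - z_1 ([laurent_span2], [laurent_span3]). By the product formula the
    resulting generators are the iterated shuffle products of (b) and (c).

    The generators must also be shown to be Laurent polynomials, although
    omega has poles. Omega_k is a Laurent polynomial N divided by the Vandermonde
    determinant, and expanding g N over the same spanning monomials reduces the
    question to Sym[m_b / Vandermonde], a quotient of two alternants. All
    exponents of m_b are less than k, so the numerator is the Vandermonde
    determinant up to sign, or has two equal rows ([Lz_alternant]). *)

Set Implicit Arguments.
Unset Strict Implicit.
Unset Printing Implicit Defensive.

Import GRing.Theory.
Local Open Scope ring_scope.

(** * Substitution of variables is a ring morphism *)

Local Notation "x %:F" := (FracField.tofrac x) (at level 1, format "x %:F").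

Lemma frac_numden (R : idomainType) (f : {fraction R}) :
  f = (\n_(repr f))%:F / (\d_(repr f))%:F.
Proof.
have dF0 : (\d_(repr f))%:F != 0 :> {fraction R}
  by rewrite tofrac_eq0 denom_ratioP.
apply: (canRL (mulfK dF0)).
rewrite -{1}[f]reprK; move: (repr f) => x {dF0}.
rewrite -[X in X = _]/(FracField.mul (\pi x)%qT (\d_x)%:F) !piE.
apply/eqmodP; rewrite /= FracField.equivfE /FracField.mulf.
by rewrite !numden_Ratio ?mulr1 ?oner_eq0 ?denom_ratioP // mulrC.
Qed.

Section Mmap.
Variables (k : nat) (R S : comNzRingType).

Lemma mmap_ext (f g : R -> S) (h h' : 'I_k -> S) (p : {mpoly R[k]}) :
  f =1 g -> h =1 h' -> mmap f h p = mmap g h' p.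
Proof.
move=> ef eh; apply: eq_bigr => m _; rewrite ef; congr (_ * _).
exact: mmap1_eq.
Qed.

Lemma rmorph_mmap (T : comNzRingType) (phi : {rmorphism S -> T}) (f : R -> S) h
  (p : {mpoly R[k]}) : phi (mmap f h p) = mmap (phi \o f) (phi \o h) p.
Proof.
rewrite /mmap rmorph_sum; apply: eq_bigr => m _.
rewrite rmorphM rmorph_prod; congr (_ * _); apply: eq_bigr => i _.
by rewrite rmorphXn.
Qed.

End Mmap.

Lemma mmap_id k (R : comNzRingType) (p : {mpoly R[k]}) :
  mmap (@mpolyC k R) (fun i => 'X_i) p = p.
Proof.
rewrite [RHS]mpolyE; apply: eq_bigr => m _.
by rewrite mmap1_id mul_mpolyC.
Qed.

Definition peval (RR : realType) k n (s : 'I_k -> 'I_n)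
    (p : {mpoly (Cq RR)[k]}) : Kz RR n :=
  mmap (@scal RR n) (fun i => zvar RR (s i)) p.

(** [subst] on variables. Injectivity keeps denominators nonzero, so that the
    value does not depend on the representative; locked, so that only its
    morphism properties are used afterwards. *)
HB.lock Definition rename (RR : realType) k n (s : 'I_k -> 'I_n)
  (s_inj : injective s) (f : Kz RR k) :
  Kz RR n := subst f (fun i => zvar RR (s i)).

(** A renaming respects sums and products only because it is computed on
    numerators and denominators by ring morphisms; this isolates that argument
    from the concrete fields. *)
Section FractionExtension.
Variables (D : idomainType) (K L : fieldType).
Variables (j : {rmorphism D -> K}) (e : {rmorphism D -> L}) (r : K -> L).
Hypothesis j0 : forall a, a != 0 -> j a != 0.
Hypothesis e0 : forall a, a != 0 -> e a != 0.
Hypothesis (jP : forall f, exists a b, b != 0 /\ f = j a / j b).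
Hypothesis (rE : forall a b, b != 0 -> r (j a / j b) = e a / e b).

Let subf_div (F : fieldType) (x y z t : F) : y != 0 -> t != 0 ->
  x / y - z / t = (x * t - z * y) / (y * t).
Proof. by move=> y0 t0; rewrite -mulNr addf_div // mulNr. Qed.

Lemma frac_ext_zmod : zmod_morphism r.
Proof.
move=> f g; have [a [b [b0 ->]]] := jP f; have [c [d [d0 ->]]] := jP g.
rewrite !rE // !subf_div ?j0 ?e0 //.
by rewrite -!rmorphM -!rmorphB rE ?mulf_neq0.
Qed.

Lemma frac_ext_monoid : monoid_morphism r.
Proof.
split; first by rewrite -[1]divr1 -(rmorph1 j) rE ?oner_eq0 // rmorph1 divr1.
move=> f g; have [a [b [b0 ->]]] := jP f; have [c [d [d0 ->]]] := jP g.
by rewrite !rE // !mulf_div -!rmorphM rE ?mulf_neq0.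
Qed.

End FractionExtension.

Section Renaming.
Variable RR : realType.
Implicit Types k n m : nat.

HB.instance Definition _ k n (s : 'I_k -> 'I_n) :=
  GRing.RMorphism.copy (@peval RR k n s)
    (mmap (@scal RR n) (fun i => zvar RR (s i))).

(** The values of [peval s] are polynomials; being explicit about them reduces
    the nonvanishing of denominators to injectivity on polynomials. *)
Definition pren k n (s : 'I_k -> 'I_n) (p : {mpoly (Cq RR)[k]}) :
    {mpoly (Cq RR)[n]} :=
  mmap (@mpolyC n (Cq RR)) (fun i => 'X_(s i)) p.

Lemma peval_pren k n (s : 'I_k -> 'I_n) (p : {mpoly (Cq RR)[k]}) :
  peval s p = (pren s p)%:F.
Proof. by rewrite /pren rmorph_mmap. Qed.

(** An injective renaming is undone by the substitution sending the variables
    outside its image to 0. *)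
Lemma pren_inj k n (s : 'I_k -> 'I_n) : injective s -> injective (pren s).
Proof.
move=> s_inj.
pose h (j : 'I_n) : {mpoly (Cq RR)[k]} :=
  if [pick i | s i == j] is Some i then 'X_i else 0.
apply: (can_inj (g := mmap (@mpolyC k (Cq RR)) h)) => p.
rewrite /pren rmorph_mmap -[RHS]mmap_id; apply: mmap_ext => [c|i] /=.
  by rewrite mmapC.
rewrite mmapX mmap1U /h; case: pickP => [j /eqP/s_inj -> //|].
by move/(_ i); rewrite eqxx.
Qed.

Lemma peval_eq0 k n (s : 'I_k -> 'I_n) (p : {mpoly (Cq RR)[k]}) :
  injective s -> (peval s p == 0) = (p == 0).
Proof.
move=> s_inj; rewrite peval_pren tofrac_eq0.
have s0 : pren s 0 = 0 by exact: mmap0.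
apply/eqP/eqP => [p0|->]; last exact: s0.
by apply: (pren_inj s_inj); rewrite p0 s0.
Qed.

Section Rename.
Context k n (s : 'I_k -> 'I_n) (s_inj : injective s).
Local Notation ren := (@rename RR k n s s_inj).

Lemma renameE f : subst f (fun i => zvar RR (s i)) = ren f.
Proof. by rewrite rename.unlock. Qed.

(** Independence of the representative: both fractions cross-multiply to the
    same polynomial identity, and [peval s] keeps denominators nonzero. *)
Lemma rename_frac (a b : {mpoly (Cq RR)[k]}) :
  b != 0 -> ren (a%:F / b%:F) = peval s a / peval s b.
Proof.
move=> b0; rewrite rename.unlock /subst -!/(@peval RR k n s _).
set f : Kz RR k := a%:F / b%:F.
have d0 : \d_(repr f) != 0 by rewrite denom_ratioP.
apply/eqP; rewrite eqr_div ?peval_eq0 // -!rmorphM /=; apply/eqP; congr peval.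
apply/eqP; rewrite -tofrac_eq !tofracM -eqr_div ?tofrac_eq0 //.
by rewrite -frac_numden.
Qed.

Lemma fracP (f : Kz RR k) : exists a b, b != 0 /\ f = a%:F / b%:F.
Proof.
exists \n_(repr f), \d_(repr f); split; first exact: denom_ratioP.
exact: frac_numden.
Qed.

Lemma rename_tofrac a : ren a%:F = peval s a.
Proof.
by rewrite -[a%:F]divr1 -tofrac1 rename_frac ?oner_eq0 // rmorph1 divr1.
Qed.

Lemma rename_scal c : ren (scal k c) = scal n c.
Proof. by rewrite rename_tofrac /peval mmapC. Qed.

Lemma rename_zvar i : ren (zvar RR i) = zvar RR (s i).
Proof. by rewrite rename_tofrac /peval mmapX mmap1U. Qed.

Let tofrac_neq0 (a : {mpoly (Cq RR)[k]}) : a != 0 -> a%:F != 0 :> Kz RR k.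
Proof. by rewrite tofrac_eq0. Qed.

Let peval_neq0 (a : {mpoly (Cq RR)[k]}) : a != 0 -> peval s a != 0.
Proof. by rewrite peval_eq0. Qed.

Lemma rename_is_zmod : zmod_morphism ren.
Proof. exact: frac_ext_zmod tofrac_neq0 peval_neq0 fracP rename_frac. Qed.

Lemma rename_is_monoid : monoid_morphism ren.
Proof. exact: frac_ext_monoid fracP rename_frac. Qed.

HB.instance Definition _ :=
  GRing.isZmodMorphism.Build (Kz RR k) (Kz RR n) ren rename_is_zmod.
HB.instance Definition _ :=
  GRing.isMonoidMorphism.Build (Kz RR k) (Kz RR n) ren rename_is_monoid.

End Rename.

Lemma rename_comp k n m (s : 'I_k -> 'I_n) (t : 'I_n -> 'I_m) (u : 'I_k -> 'I_m)
    (hs : injective s) (ht : injective t) (hu : injective u) (f : Kz RR k) :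
  u =1 t \o s -> rename ht (rename hs f) = rename hu f.
Proof.
move=> ust; have [a [b [b0 ->]]] := fracP f.
have E (p : {mpoly (Cq RR)[k]}) : rename ht (peval s p) = peval u p.
  rewrite rmorph_mmap; apply: mmap_ext => [c|i] /=; first by rewrite rename_scal.
  by rewrite rename_zvar ust.
by rewrite !rename_frac // fmorph_div /= !E.
Qed.

Lemma rename_id k (s : 'I_k -> 'I_k) (hs : injective s) (f : Kz RR k) :
  s =1 id -> rename hs f = f.
Proof.
move=> sid; have [a [b [b0 ->]]] := fracP f.
have E (p : {mpoly (Cq RR)[k]}) : peval s p = p%:F.
  rewrite peval_pren; congr FracField.tofrac; rewrite -[RHS]mmap_id.
  by apply: mmap_ext => // i; rewrite sid.
by rewrite rename_frac // !E.
Qed.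

End Renaming.

(** * Variables and integers in the field of rational functions *)

Lemma mpolyXi_neq0 (R : nzRingType) n (i : 'I_n) : 'X_i != 0 :> {mpoly R[n]}.
Proof.
apply/eqP => /(congr1 (mcoeff U_(i))) /eqP.
by rewrite mcoeffX eqxx mcoeff0 oner_eq0.
Qed.

Section NonVanishing.
Variable RR : realType.

Lemma zvar_inj k : injective (@zvar RR k).
Proof.
move=> i i' /eqP; rewrite /zvar tofrac_eq => /eqP/(congr1 (mcoeff U_(i))).
rewrite !mcoeffX eqxx; case: eqVneq => [|_ /eqP]; last by rewrite oner_eq0.
by move/mnmP/(_ i); rewrite !mnmE eqxx; case: eqP.
Qed.

Lemma zvar_neq0 k (i : 'I_k) : zvar RR i != 0.
Proof. by rewrite /zvar tofrac_eq0 mpolyXi_neq0. Qed.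

Lemma natr_Kz_neq0 k n : (n.+1%:R : Kz RR k) != 0.
Proof.
have -> : (n.+1%:R : Kz RR k) =
    scal k (FracField.tofrac (n.+1%:R : complex RR)%:MP_[2]).
  by rewrite !rmorph_nat.
rewrite fmorph_eq0 tofrac_eq0 mpolyC_eq0.
exact: (Num.Theory.lt0r_neq0 (Num.Theory.ltr0Sn _ n)).
Qed.
End NonVanishing.

(* From here on only the field structure, and the nonvanishing and distinctness
   of the variables, matter. *)
Local Opaque Kz scal zvar.

(** * Laurent polynomials *)

Section Laurent.
Variables (L : fieldType) (n : nat) (S : L -> Prop) (x : 'I_n -> L).
Local Notation laurent := (laurent S x).

Lemma laurent0 : laurent 0.
Proof. by exists [::] => //; rewrite big_nil. Qed.

Lemma laurentD f g : laurent f -> laurent g -> laurent (f + g).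
Proof.
move=> [s Ss ->] [t St ->]; exists (s ++ t); last by rewrite big_cat.
by move=> u; rewrite mem_cat => /orP[/Ss|/St].
Qed.

Lemma laurent_monomial a (d : {ffun 'I_n -> int}) :
  S a -> laurent (a * \prod_i x i ^ d i).
Proof.
move=> Sa; exists [:: (a, d)]; last by rewrite big_seq1.
by move=> u; rewrite inE => /eqP ->.
Qed.

Lemma laurent_ind (P : L -> Prop) :
  P 0 -> (forall f g, P f -> P g -> P (f + g)) ->
  (forall a (d : {ffun 'I_n -> int}), S a -> P (a * \prod_i x i ^ d i)) ->
  forall f, laurent f -> P f.
Proof.
move=> P0 PD PM f [s Ss ->]; rewrite big_seq.
by elim/big_ind: _ => // t /Ss; apply: PM.
Qed.

Hypothesis S1 : S 1.
Hypothesis SM : forall a b, S a -> S b -> S (a * b).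
Hypothesis x0 : forall i, x i != 0.

Lemma laurentC a : S a -> laurent a.
Proof.
move=> Sa; have := laurent_monomial [ffun=> 0] Sa.
by rewrite big1 ?mulr1 // => i _; rewrite ffunE expr0z.
Qed.

Lemma laurentX i (d : int) : laurent (x i ^ d).
Proof.
have := laurent_monomial [ffun j => if j == i then d else 0] S1.
rewrite mul1r (bigD1 i) //= big1 => [|j /negPf ji]; rewrite ffunE ?eqxx ?mulr1 //.
by rewrite ji expr0z.
Qed.

Lemma laurentM f g : laurent f -> laurent g -> laurent (f * g).
Proof.
move=> Lf Lg; elim/laurent_ind: f / Lf => [|f f' IHf IHf'|a d Sa].
- by rewrite mul0r; apply: laurent0.
- by rewrite mulrDl; apply: laurentD.
elim/laurent_ind: g / Lg => [|g g' IHg IHg'|b e Sb].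
- by rewrite mulr0; apply: laurent0.
- by rewrite mulrDr; apply: laurentD.
rewrite mulrACA -big_split /=.
rewrite (eq_bigr (fun i => x i ^ [ffun i => d i + e i] i)).
  exact: laurent_monomial (SM Sa Sb).
by move=> i _; rewrite ffunE expfzDr.
Qed.

Lemma laurent_prod I (r : seq I) (P : pred I) F :
  (forall i, P i -> laurent (F i)) -> laurent (\prod_(i <- r | P i) F i).
Proof.
by move=> LF; elim/big_ind: _ => //; [apply: laurentC | apply: laurentM].
Qed.

Lemma laurent_sum I (r : seq I) (P : pred I) F :
  (forall i, P i -> laurent (F i)) -> laurent (\sum_(i <- r | P i) F i).
Proof.
by move=> LF; elim/big_ind: _ => //; [apply: laurent0 | apply: laurentD].
Qed.
End Laurent.

Section Coefficients.
Variable RR : realType.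
Local Notation isC := (fun a : Cq RR => exists c : complex RR, a = Cconst c).

Lemma CconstM (c d : complex RR) : Cconst c * Cconst d = Cconst (c * d).
Proof. by rewrite /Cconst -rmorphM -mpolyCM. Qed.

Let isC1 : isC 1. Proof. by exists 1; rewrite /Cconst mpolyC1 rmorph1. Qed.
Let isCM a b : isC a -> isC b -> isC (a * b).
Proof. by move=> [c ->] [d ->]; exists (c * d); rewrite CconstM. Qed.
Let qvar_neq0 i : qvar RR i != 0.
Proof. by rewrite /qvar tofrac_eq0 mpolyXi_neq0. Qed.

Lemma Rq1 : Rq (1 : Cq RR). Proof. exact: laurentC. Qed.
Lemma RqN1 : Rq (-1 : Cq RR).
Proof.
by apply: laurentC; exists (-1); rewrite /Cconst mpolyCN mpolyC1 rmorphN rmorph1.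
Qed.
Lemma RqM (a b : Cq RR) : Rq a -> Rq b -> Rq (a * b).
Proof. exact: laurentM. Qed.
Lemma Rq_q1 : Rq (q1 RR). Proof. exact: (laurentX _ isC1 ord0 1). Qed.
Lemma Rq_q2 : Rq (q2 RR). Proof. exact: (laurentX _ isC1 ord_max 1). Qed.
Lemma Rq0 : Rq (0 : Cq RR). Proof. exact: laurent0. Qed.
End Coefficients.

Section LaurentInZ.
Variable RR : realType.
Implicit Types k n : nat.

Definition Lz k : Kz RR k -> Prop :=
  laurent (fun a => exists2 r : Cq RR, Rq r & a = scal k r) (@zvar RR k).

Let isR k := fun a : Kz RR k => exists2 r : Cq RR, Rq r & a = scal k r.
Let isR1 k : @isR k 1. Proof. by exists 1; rewrite ?rmorph1 //; apply: Rq1. Qed.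
Let isRM k (a b : Kz RR k) : isR a -> isR b -> isR (a * b).
Proof.
by move=> [r Rr ->] [s Rs ->]; exists (r * s); rewrite ?rmorphM //; apply: RqM.
Qed.

Lemma Lz0 k : @Lz k 0. Proof. exact: laurent0. Qed.
Lemma LzD k (f g : Kz RR k) : Lz f -> Lz g -> Lz (f + g).
Proof. exact: laurentD. Qed.
Lemma LzM k (f g : Kz RR k) : Lz f -> Lz g -> Lz (f * g).
Proof. by apply: laurentM => //; [apply: isRM | apply: zvar_neq0]. Qed.
Lemma Lz_scal k (r : Cq RR) : Rq r -> Lz (scal k r).
Proof. by move=> Rr; apply: laurentC; exists r. Qed.
Lemma Lz1 k : @Lz k 1. Proof. by apply: laurentC; apply: isR1. Qed.
Lemma LzN k (f : Kz RR k) : Lz f -> Lz (- f).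
Proof.
move=> Lf; rewrite -mulN1r; apply: LzM => //.
have -> : -1 = scal k (-1 : Cq RR) by rewrite rmorphN rmorph1.
exact/Lz_scal/RqN1.
Qed.
Lemma LzB k (f g : Kz RR k) : Lz f -> Lz g -> Lz (f - g).
Proof. by move=> Lf Lg; apply: LzD => //; apply: LzN. Qed.
Lemma Lz_zvarX k (i : 'I_k) (d : int) : Lz (zvar RR i ^ d).
Proof. by apply: laurentX; apply: isR1. Qed.
Lemma Lz_zvar k (i : 'I_k) : Lz (zvar RR i).
Proof. exact: (Lz_zvarX i 1). Qed.
Lemma Lz_sum k I (r : seq I) (P : pred I) (F : I -> Kz RR k) :
  (forall i, P i -> Lz (F i)) -> Lz (\sum_(i <- r | P i) F i).
Proof. exact: laurent_sum. Qed.
Lemma Lz_prod k I (r : seq I) (P : pred I) (F : I -> Kz RR k) :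
  (forall i, P i -> Lz (F i)) -> Lz (\prod_(i <- r | P i) F i).
Proof. by apply: laurent_prod; [apply: isR1|apply: isRM|apply: zvar_neq0]. Qed.

Lemma Lz_ind k (P : Kz RR k -> Prop) :
  P 0 -> (forall f g, P f -> P g -> P (f + g)) ->
  (forall r (d : {ffun 'I_k -> int}), Rq r ->
     P (scal k r * \prod_i zvar RR i ^ d i)) ->
  forall f, Lz f -> P f.
Proof.
move=> P0 PD PM; apply: laurent_ind => // a d [r Rr ->]; exact: PM.
Qed.

Lemma Lz_rename k n (s : 'I_k -> 'I_n) (s_inj : injective s) (f : Kz RR k) :
  Lz f -> Lz (rename s_inj f).
Proof.
elim/Lz_ind => [|g h Lg Lh|r d Rr].
- by rewrite rmorph0; apply: Lz0.
- by rewrite rmorphD; apply: LzD.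
rewrite rmorphM /= rename_scal rmorph_prod; apply: LzM; first exact: Lz_scal.
by apply: Lz_prod => i _; rewrite fmorphXz /= rename_zvar; apply: Lz_zvarX.
Qed.
End LaurentInZ.

Local Notation renp s := (rename (@perm_inj _ s)).
Local Notation inl_ k l := (rename (@lshift_inj k l)).
Local Notation inr_ k l := (rename (@rshift_inj k l)).

(** * Symmetrization and the shuffle product *)

Section Symmetrization.
Variable RR : realType.
Implicit Types k l n : nat.

Definition symmetric_fun k (f : Kz RR k) := forall s : 'S_k, renp s f = f.

Lemma VzE k (f : Kz RR k) : Vz f <-> Lz f /\ symmetric_fun f.
Proof.
by split=> -[Lf Sf]; split=> // s; have := Sf s; rewrite (renameE (@perm_inj _ s)).
Qed.

Lemma SymzE k (f : Kz RR k) : Symz f = \sum_(s : 'S_k) renp s f.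
Proof. by apply: eq_bigr => s _; rewrite (renameE (@perm_inj _ s)). Qed.

Lemma Symz0 k : Symz (0 : Kz RR k) = 0.
Proof. by rewrite SymzE big1 // => s _; rewrite rmorph0. Qed.

Lemma SymzD k (f g : Kz RR k) : Symz (f + g) = Symz f + Symz g.
Proof. by rewrite !SymzE -big_split; apply: eq_bigr => s _; rewrite rmorphD. Qed.

Lemma Symz_sum k I (r : seq I) (P : pred I) (F : I -> Kz RR k) :
  Symz (\sum_(i <- r | P i) F i) = \sum_(i <- r | P i) Symz (F i).
Proof. by apply: big_morph; [apply: SymzD | apply: Symz0]. Qed.

Lemma SymzM k (f g : Kz RR k) : symmetric_fun f -> Symz (f * g) = f * Symz g.
Proof.
move=> Sf; rewrite !SymzE mulr_sumr; apply: eq_bigr => s _.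
by rewrite rmorphM /= Sf.
Qed.

Lemma symmetric_scal k r : symmetric_fun (@scal RR k r).
Proof. by move=> s; rewrite rename_scal. Qed.

Lemma Symz_rename k (t : 'S_k) (f : Kz RR k) : Symz (renp t f) = Symz f.
Proof.
rewrite !SymzE [RHS](reindex_inj (mulgI t)) /=; apply: eq_bigr => s _.
by apply: rename_comp => i; rewrite permM.
Qed.

Lemma symmetric_Symz k (f : Kz RR k) : symmetric_fun (Symz f).
Proof.
move=> t; rewrite !SymzE rmorph_sum [RHS](reindex_inj (mulIg t)) /=.
apply: eq_bigr => s _.
by apply: rename_comp => i; rewrite permM.
Qed.

Lemma rename_omega k n (s : 'I_k -> 'I_n) (hs : injective s) i j :
  rename hs (omega RR i j) = omega RR (s i) (s j).
Proof.
by rewrite /omega fmorph_div !(rmorphM, rmorphB) /= !rename_scal !rename_zvar.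
Qed.

Definition omegas k : Kz RR k :=
  \prod_(i < k) \prod_(j < k | (i < j)%N) omega RR i j.

Lemma omegas_small k : (k <= 1)%N -> omegas k = 1.
Proof.
move=> k1; rewrite /omegas big1 // => i _; apply: big_pred0 => j.
by apply/negbTE; rewrite -leqNgt -ltnS (leq_trans (ltn_ord j)) // (leq_trans k1).
Qed.

Definition cross k l : Kz RR (k + l) :=
  \prod_(i < k) \prod_(j < l) omega RR (lshift l i) (rshift k j).

Lemma omegas_add k l :
  omegas (k + l) = inl_ k l (omegas k) * inr_ k l (omegas l) * cross k l.
Proof.
rewrite [RHS]mulrAC /omegas [LHS]big_split_ord /=; congr (_ * _).
  rewrite rmorph_prod -big_split; apply: eq_bigr => i _ /=.
  rewrite [LHS]big_split_ord /= [X in _ = X * _]rmorph_prod; congr (_ * _).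
    by apply: eq_bigr => j _; rewrite /= rename_omega.
  apply: eq_bigl => j; exact: leq_trans (ltn_ord i) (leq_addr _ _).
rewrite rmorph_prod; apply: eq_bigr => i _ /=.
rewrite [LHS]big_split_ord /= [X in X * _ = _]big_pred0 ?mul1r => [|j]; last first.
  by apply/negbTE; rewrite -leqNgt ltnW // (leq_trans (ltn_ord j)) ?leq_addr.
rewrite rmorph_prod; apply: eq_big => [j|j _]; first by rewrite ltn_add2l.
by rewrite /= rename_omega.
Qed.

(** The embedding of S_k x S_l in S_(k+l) by permutations of the first k and of
    the last l variables. *)
Section Glue.
Context k l (s : 'S_k) (t : 'S_l).

Definition glue_fun (i : 'I_(k + l)) : 'I_(k + l) :=
  match split i with inl i => lshift l (s i) | inr j => rshift k (t j) end.

Lemma glue_fun_inj : injective glue_fun.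
Proof.
move=> i j; rewrite /glue_fun => e; rewrite -(splitK i) -(splitK j); move: e.
case: (split i) => i'; case: (split j) => j'.
- by move/lshift_inj/perm_inj ->.
- by move/eqP; rewrite eq_lrshift.
- by move/eqP; rewrite eq_rlshift.
- by move/rshift_inj/perm_inj ->.
Qed.

Definition glue : 'S_(k + l) := perm glue_fun_inj.

Lemma glueL i : glue (lshift l i) = lshift l (s i).
Proof. by rewrite permE /glue_fun (unsplitK (inl i)). Qed.

Lemma glueR j : glue (rshift k j) = rshift k (t j).
Proof. by rewrite permE /glue_fun (unsplitK (inr j)). Qed.

Lemma glue_cross : renp glue (cross k l) = cross k l.
Proof.
rewrite /cross rmorph_prod [RHS](reindex_inj (@perm_inj _ s)) /=.
apply: eq_bigr => i _; rewrite rmorph_prod [RHS](reindex_inj (@perm_inj _ t)) /=.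
by apply: eq_bigr => j _; rewrite rename_omega glueL glueR.
Qed.

Lemma glue_inl (f : Kz RR k) :
  renp glue (inl_ k l f) = inl_ k l (renp s f).
Proof.
have h : injective (fun i => lshift l (s i)) by move=> i j /lshift_inj/perm_inj.
rewrite (rename_comp _ _ h) => [|i]; last by rewrite /= glueL.
by rewrite (rename_comp _ _ h).
Qed.

Lemma glue_inr (f : Kz RR l) :
  renp glue (inr_ k l f) = inr_ k l (renp t f).
Proof.
have h : injective (fun i => rshift k (t i)) by move=> i j /rshift_inj/perm_inj.
rewrite (rename_comp _ _ h) => [|i]; last by rewrite /= glueR.
by rewrite (rename_comp _ _ h).
Qed.
End Glue.

Local Opaque cross omegas omega.

Lemma shuffleE k l (P : Kz RR k) (Q : Kz RR l) :
  shuffle P Q = (k`! * l`!)%:R^-1 * Symz (inl_ k l P * inr_ k l Q * cross k l).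
Proof.
by rewrite /shuffle (renameE (@lshift_inj k l)) (renameE (@rshift_inj k l)).
Qed.

Let mulr_sum2 (R : nzRingType) (I J : finType) (a : I -> R) (b : J -> R) c :
  (\sum_i a i) * (\sum_j b j) * c = \sum_i \sum_j a i * b j * c.
Proof.
rewrite !mulr_suml; apply: eq_bigr => i _.
by rewrite mulr_sumr mulr_suml.
Qed.

(** Expanding both symmetrizations turns the argument of Sym into a sum over
    (s, t) in S_k x S_l of translates of one function by [glue s t], since the
    cross factor is invariant; Sym does not see the translations, and the
    k! l! equal terms cancel the normalization. *)
Lemma shuffle_Symz k l (G : Kz RR k) (H : Kz RR l) :
  shuffle (Symz G) (Symz H) = Symz (inl_ k l G * inr_ k l H * cross k l).
Proof.
rewrite shuffleE; set F := inl_ k l G * _ * _.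
have -> : inl_ k l (Symz G) * inr_ k l (Symz H) * cross k l =
    \sum_(s : 'S_k) \sum_(t : 'S_l) renp (glue s t) F.
  rewrite !SymzE !rmorph_sum /= mulr_sum2; apply: eq_bigr => s _.
  apply: eq_bigr => t _.
  by rewrite /F !rmorphM /= glue_inl glue_inr glue_cross.
rewrite Symz_sum (eq_bigr (fun _ => Symz F *+ l`!)) => [|s _]; last first.
  rewrite Symz_sum (eq_bigr (fun _ => Symz F)) => [|t _]; last exact: Symz_rename.
  by rewrite sumr_const card_Sn.
rewrite sumr_const card_Sn -mulrnA mulnC -[Symz F *+ _]mulr_natl mulrA mulVf ?mul1r //.
by rewrite -(prednK (fact_gt0 k)) -(prednK (fact_gt0 l)) mulSn natr_Kz_neq0.
Qed.

(** The class of the Sym[g Omega_k] is stable under the shuffle product, which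
    acts on the functions g as a tensor product. *)
Lemma shuffle_omegas k l (g : Kz RR k) (h : Kz RR l) :
  shuffle (Symz (g * omegas k)) (Symz (h * omegas l)) =
  Symz (inl_ k l g * inr_ k l h * omegas (k + l)).
Proof.
rewrite shuffle_Symz omegas_add !rmorphM /=; congr Symz.
by rewrite [X in X * cross _ _]mulrACA -[LHS]mulrA.
Qed.

End Symmetrization.

(** * The integral shuffle algebra in degree k *)

Section Integral.
Variable RR : realType.
Local Opaque omegas omega cross.
Implicit Types k l n : nat.

Definition omega_sym k (P : Kz RR k) :=
  exists2 g, Lz g & P = Symz (g * omegas RR k).

Lemma omega_sym0 k : omega_sym (0 : Kz RR k).
Proof. by exists 0; [apply: Lz0 | rewrite mul0r Symz0]. Qed.

Lemma omega_symD k (P Q : Kz RR k) :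
  omega_sym P -> omega_sym Q -> omega_sym (P + Q).
Proof.
move=> [g Lg ->] [h Lh ->]; exists (g + h); first exact: LzD.
by rewrite mulrDl SymzD.
Qed.

Lemma omega_symM k (f P : Kz RR k) : Lz f -> symmetric_fun f ->
  omega_sym P -> omega_sym (f * P).
Proof.
move=> Lf Sf [g Lg ->]; exists (f * g); first exact: LzM.
by rewrite -mulrA [RHS]SymzM.
Qed.

Lemma omega_sym_shuffle k l (P : Kz RR k) (Q : Kz RR l) :
  omega_sym P -> omega_sym Q -> omega_sym (shuffle P Q).
Proof.
move=> [g Lg ->] [h Lh ->]; exists (inl_ k l g * inr_ k l h).
  by apply: LzM; apply: Lz_rename.
exact: shuffle_omegas.
Qed.

(** With at most one variable there is nothing to symmetrize, so the elements of
    V_0 and V_1 are themselves of the form Sym[g Omega_k]. *)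
Lemma Symz_omegas_small k (g : Kz RR k) : (k <= 1)%N ->
  Symz (g * omegas RR k) = g.
Proof.
move=> k1; rewrite SymzE (bigD1 1%g) //= big_pred0 => [|s].
  by rewrite addr0 omegas_small // mulr1 rename_id // => i; rewrite perm1.
apply/negbTE; rewrite negbK; apply/eqP/permP => i; rewrite perm1.
by case: k k1 i s {g} => [|[|]] // _ i s; rewrite ?ord1 //; case: i.
Qed.

Lemma omega_sym_small k (g : Kz RR k) : (k <= 1)%N -> Lz g -> omega_sym g.
Proof. by move=> k1 Lg; exists g; rewrite // Symz_omegas_small. Qed.

Lemma omega_sym_ecast m n (e : m = n) (P : Kz RR m) :
  omega_sym P -> omega_sym (ecast i (Kz RR i) e P).
Proof. by case: n / e. Qed.

Lemma in_degree_cases k (P : Kz RR k) (A : forall n, Kz RR n -> Prop) n :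
  A k P -> (k != n -> A n 0) -> A n (in_degree P n).
Proof.
rewrite /in_degree; case: eqP => [e|/eqP ne] AP A0; last exact: A0.
by case: n / e A0.
Qed.

Lemma shuffle_gen_omega_sym (f : graded RR) :
  shuffle_gen f -> forall k, omega_sym (f k).
Proof.
elim=> {f} [d|  |f g _ IHf _ IHg|r f Rr _ IHf|f g _ IHf _ IHg] k.
- apply: in_degree_cases => [|_]; last exact: omega_sym0.
  by apply: omega_sym_small => //; apply: Lz_zvarX.
- apply: in_degree_cases => [|_]; last exact: omega_sym0.
  by apply: omega_sym_small => //; apply: Lz1.
- exact: omega_symD.
- by apply: omega_symM => //; [apply: Lz_scal | apply: symmetric_scal].
rewrite /shuffle_graded; elim/big_ind: _ => [||i _]; first exact: omega_sym0.
  exact: omega_symD.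
by apply: omega_sym_ecast; apply: omega_sym_shuffle.
Qed.

Lemma in_degree_id k (P : Kz RR k) : in_degree P k = P.
Proof. by rewrite /in_degree; case: eqP => // e; rewrite eq_axiomK. Qed.

Lemma in_degree_neq k n (P : Kz RR k) : k != n -> in_degree P n = 0.
Proof. by rewrite /in_degree; case: eqP. Qed.

Lemma gradedP (f g : graded RR) : (forall n, f n = g n) -> f = g.
Proof. exact: functional_extensionality_dep. Qed.

Lemma in_degreeD k (P Q : Kz RR k) :
  in_degree (P + Q) = (fun n => in_degree P n + in_degree Q n).
Proof.
apply: gradedP => n; rewrite /in_degree; case: eqP => [e|_]; last by rewrite addr0.
by case: n / e.
Qed.

Lemma in_degree_scal k r (P : Kz RR k) :
  in_degree (scal k r * P) = (fun n => scal n r * in_degree P n).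
Proof.
apply: gradedP => n; rewrite /in_degree; case: eqP => [e|_]; last by rewrite mulr0.
by case: n / e.
Qed.

Lemma shufflez0 k l (P : Kz RR k) : shuffle P (0 : Kz RR l) = 0.
Proof. by rewrite shuffleE rmorph0 mulr0 mul0r Symz0 mulr0. Qed.

Lemma shuffle0z k l (P : Kz RR l) : shuffle (0 : Kz RR k) P = 0.
Proof. by rewrite shuffleE rmorph0 !mul0r Symz0 mulr0. Qed.

Lemma in_degree_shuffle k l (P : Kz RR k) (Q : Kz RR l) :
  in_degree (shuffle P Q) = shuffle_graded (in_degree P) (in_degree Q).
Proof.
apply: gradedP => n; rewrite /shuffle_graded.
(* Only the summand i = k can survive, and it does so only when n - k = l. *)
have term i j (e : (i + j)%N = n) :
    ecast m (Kz RR m) e (shuffle (in_degree P i) (in_degree Q j)) =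
    if i == k then in_degree (shuffle P Q) n else 0.
  case: n / e; have [->|ik] := eqVneq i k; last first.
    by rewrite in_degree_neq 1?eq_sym // shuffle0z.
  rewrite in_degree_id; have [<-|jl] := eqVneq l j; first by rewrite !in_degree_id.
  by rewrite !in_degree_neq ?shufflez0 // eqn_add2l.
rewrite (eq_bigr _ (fun i _ => term _ _ _)) -big_mkcond /=.
have [kn|nk] := ltnP k n.+1; first by rewrite (big_pred1 (Ordinal kn)).
rewrite big_pred0 => [|i]; last first.
  by apply/negbTE; rewrite neq_ltn (leq_trans (ltn_ord i) nk).
by rewrite in_degree_neq // neq_ltn orbC (leq_trans nk) ?leq_addr.
Qed.

(** The generated algebra contains 0 as the multiple of the unit by the scalar
    0. *)
Lemma gen_degree0 k : shuffle_gen (in_degree (0 : Kz RR k)).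
Proof.
have -> : (0 : Kz RR k) = scal k 0 * 0 by rewrite mulr0.
rewrite in_degree_scal.
have -> : (fun n => scal n 0 * in_degree (0 : Kz RR k) n) =
          (fun n => scal n 0 * in_degree (1 : Kz RR 0) n).
  by apply: gradedP => n; rewrite rmorph0 !mul0r.
by apply: gen_scale; [apply: Rq0 | apply: gen_one].
Qed.

Lemma gen_degree_shuffle k l (P : Kz RR k) (Q : Kz RR l) :
  shuffle_gen (in_degree P) -> shuffle_gen (in_degree Q) ->
  shuffle_gen (in_degree (shuffle P Q)).
Proof. by move=> gP gQ; rewrite in_degree_shuffle; apply: gen_shuffle. Qed.

(** Sym[z^d Omega_k] is z_1^(d_1) * ... * z_1^(d_k), by splitting off the first
    variable. *)
Lemma gen_degree_monomial k (d : 'I_k -> int) :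
  shuffle_gen (in_degree (Symz ((\prod_(i < k) zvar RR i ^ d i) * omegas RR k))).
Proof.
elim: k d => [|k IHk] d.
  by rewrite Symz_omegas_small // big_ord0; apply: gen_one.
rewrite -[k.+1]/(1 + k)%N in d *.
have -> : Symz ((\prod_(i < 1 + k) zvar RR i ^ d i) * omegas RR (1 + k)) =
  shuffle (zpow RR (d (lshift k ord0)))
    (Symz ((\prod_(i < k) zvar RR i ^ d (rshift 1 i)) * omegas RR k)).
  rewrite -[zpow _ _](@Symz_omegas_small 1) // shuffle_omegas; congr (Symz (_ * _)).
  rewrite [LHS]big_split_ord; congr (_ * _).
    by rewrite [LHS]big_ord1 /zpow fmorphXz /= rename_zvar.
  by rewrite rmorph_prod; apply: eq_bigr => i _; rewrite fmorphXz /= rename_zvar.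
by apply: gen_degree_shuffle => //; apply: gen_zpow.
Qed.

Lemma gen_degree_omega_sym k (P : Kz RR k) :
  omega_sym P -> shuffle_gen (in_degree P).
Proof.
move=> [g Lg ->]; elim/Lz_ind: g / Lg => [|g h gg gh|r d Rr].
- by rewrite mul0r Symz0; apply: gen_degree0.
- by rewrite mulrDl SymzD in_degreeD; apply: gen_add.
rewrite -mulrA SymzM ?in_degree_scal; last exact: symmetric_scal.
by apply: gen_scale => //; apply: gen_degree_monomial.
Qed.

Lemma Vz0 k : Vz (0 : Kz RR k).
Proof. by apply/VzE; split; [apply: Lz0 | move=> s; rewrite rmorph0]. Qed.

Lemma VzD k (f g : Kz RR k) : Vz f -> Vz g -> Vz (f + g).
Proof.
move=> /VzE[Lf Sf] /VzE[Lg Sg]; apply/VzE; split; first exact: LzD.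
by move=> s; rewrite rmorphD /= Sf Sg.
Qed.

Lemma VzM k (f g : Kz RR k) : Vz f -> Vz g -> Vz (f * g).
Proof.
move=> /VzE[Lf Sf] /VzE[Lg Sg]; apply/VzE; split; first exact: LzM.
by move=> s; rewrite rmorphM /= Sf Sg.
Qed.

(** The components of [in_degree P] in degrees other than k vanish, so membership
    in the algebra is a condition on P alone. *)
Lemma ARkE k (P : Kz RR k) : ARk P <-> Vz P /\ omega_sym P.
Proof.
split=> [[VP [_ /shuffle_gen_omega_sym/(_ k)]]|[VP AP]]; first by rewrite in_degree_id.
split=> //; split; last exact: gen_degree_omega_sym.
split=> [n|]; first by apply: in_degree_cases => // _; apply: Vz0.
by exists k.+1 => n kn; rewrite in_degree_neq // neq_ltn kn.
Qed.

Lemma ARk_submodule k : Vz_submodule (@ARk RR k).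
Proof.
split=> [P /ARkE[]//||P Q /ARkE[VP AP] /ARkE[VQ AQ]|f P Vf /ARkE[VP AP]].
- by apply/ARkE; split; [apply: Vz0 | apply: omega_sym0].
- by apply/ARkE; split; [apply: VzD | apply: omega_symD].
apply/ARkE; split; first exact: VzM.
by move/VzE: Vf => [Lf Sf]; apply: omega_symM.
Qed.
End Integral.

(** * Quotients by the Vandermonde determinant *)

Section Generation.
Variable RR : realType.
Implicit Types k l n : nat.

Definition vdm k : Kz RR k :=
  \det (Vandermonde k (\row_(i < k) zvar RR i)).

Lemma vdmE k :
  vdm k = \prod_(i < k) \prod_(j < k | (i < j)%N) (zvar RR j - zvar RR i).
Proof.
rewrite /vdm det_Vandermonde; apply: eq_bigr => i _; apply: eq_bigr => j _.
by rewrite !mxE.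
Qed.

Lemma vdm_neq0 k : vdm k != 0.
Proof.
rewrite vdmE; apply/prodf_neq0 => i _; apply/prodf_neq0 => j ij.
by rewrite subr_eq0; apply/eqP => /zvar_inj e; rewrite e ltnn in ij.
Qed.

(** Renaming the variables permutes the columns of the Vandermonde matrix. *)
Lemma rename_vdm k (s : 'S_k) : renp s (vdm k) = (-1) ^+ s * vdm k.
Proof.
rewrite /vdm -det_map_mx.
set V := Vandermonde _ _.
have -> : map_mx (renp s) V = col_perm s V.
  by apply/matrixP => i j; rewrite !mxE rmorphXn /= rename_zvar.
by rewrite col_permE det_mulmx det_perm odd_permV mulrC.
Qed.

Definition monomial k (e : 'I_k -> nat) : Kz RR k :=
  \prod_(i < k) zvar RR i ^+ e i.

Definition alternant k (e : 'I_k -> nat) : Kz RR k :=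
  \det (\matrix_(i, j) zvar RR j ^+ e i).

(** Because the denominator is alternating, symmetrizing the quotient is the
    Leibniz expansion of a determinant in the numerator. *)
Lemma Symz_monomial_vdm k (e : 'I_k -> nat) :
  Symz (monomial e / vdm k) = alternant e / vdm k.
Proof.
rewrite SymzE /alternant /determinant [RHS]mulr_suml; apply: eq_bigr => s _.
rewrite fmorph_div /= rename_vdm invfM invr_sign /monomial rmorph_prod.
rewrite mulrCA mulrA; congr (_ * _ / _); apply: eq_bigr => i _.
by rewrite rmorphXn /= rename_zvar mxE.
Qed.

(** Exponents below k are either a permutation of 0, ..., k - 1, and then the
    rows are those of the Vandermonde matrix in another order, or two of them
    coincide, and then the determinant vanishes. *)
Lemma Lz_alternant k (e : 'I_k -> nat) :
  (forall i, (e i < k)%N) -> Lz (alternant e / vdm k).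
Proof.
move=> ek; pose e' i := Ordinal (ek i).
have [e_inj|/injectivePn[i [j ij eij]]] := boolP (injectiveb e'); last first.
  rewrite /alternant (determinant_alternate ij) => [|h]; last first.
    by rewrite !mxE; congr (_ ^+ _); exact: (congr1 (@nat_of_ord k) eij).
  by rewrite mul0r; apply: Lz0.
have -> : alternant e = (-1) ^+ (perm (injectiveP _ e_inj)) * vdm k.
  rewrite /vdm -det_perm -det_mulmx -row_permE; congr determinant.
  by apply/matrixP => i j; rewrite !mxE permE.
rewrite mulfK ?vdm_neq0 //; case: odd_perm; rewrite ?expr0 ?expr1.
  by apply: LzN; apply: Lz1.
exact: Lz1.
Qed.

Lemma omegas_vdm k : exists2 N, Lz N & omegas RR k = N / vdm k.
Proof.
pose a1 := scal k (q1 RR); pose a2 := scal k (q2 RR); pose z := @zvar RR k.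
pose num i j := - ((z i - a1 * a2 * z j) * (z j - a1 * z i) * (z j - a2 * z i)).
exists (\prod_(i < k) \prod_(j < k | (i < j)%N) num i j).
  apply: Lz_prod => i _; apply: Lz_prod => j _; apply: LzN.
  have La1 : Lz a1 by apply/Lz_scal/Rq_q1.
  have La2 : Lz a2 by apply/Lz_scal/Rq_q2.
  have Lzz h : Lz (z h) by apply: Lz_zvar.
  by do !apply: LzM; apply: LzB => //; do ?apply: LzM.
(* The sign in num turns the denominators z_i - z_j into z_j - z_i. *)
rewrite vdmE -prodf_div; apply: eq_bigr => i _; rewrite -prodf_div.
apply: eq_bigr => j _; rewrite /omega /num -[zvar RR j - zvar RR i]opprB invrN mulrNN.
by [].
Qed.

(** * Spanning over the symmetric Laurent polynomials *)

Lemma Vz_scal k (r : Cq RR) : Rq r -> Vz (scal k r : Kz RR k).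
Proof.
by move=> Rr; apply/VzE; split; [apply: Lz_scal | apply: symmetric_scal].
Qed.

Lemma Vz1 k : Vz (1 : Kz RR k).
Proof. by rewrite -(rmorph1 (@scal RR k)); apply/Vz_scal/Rq1. Qed.

Lemma VzN1 k : Vz (-1 : Kz RR k).
Proof. by rewrite -(rmorphN1 (@scal RR k)); apply/Vz_scal/RqN1. Qed.

Lemma Vz_prod_zvar k : Vz (\prod_(i < k) zvar RR i).
Proof.
apply/VzE; split=> [|s]; first by apply: Lz_prod => i _; apply: Lz_zvar.
rewrite rmorph_prod [RHS](reindex_inj (@perm_inj _ s)) /=.
by apply: eq_bigr => i _; rewrite rename_zvar.
Qed.

Lemma Vz_power_sum k (d : int) : Vz (\sum_(i < k) zvar RR i ^ d).
Proof.
apply/VzE; split=> [|s]; first by apply: Lz_sum => i _; apply: Lz_zvarX.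
rewrite rmorph_sum [RHS](reindex_inj (@perm_inj _ s)) /=.
by apply: eq_bigr => i _; rewrite fmorphXz /= rename_zvar.
Qed.

Lemma Vz_prod_zvarV k : Vz (\prod_(i < k) zvar RR i)^-1.
Proof.
apply/VzE; split=> [|s]; last first.
  by rewrite fmorphV /= (proj2 (iffLR (VzE _) (Vz_prod_zvar k)) s).
by rewrite -prodfV; apply: Lz_prod => i _; rewrite -exprN1; apply: Lz_zvarX.
Qed.

Definition Vspan k (I : finType) (m : I -> Kz RR k) (f : Kz RR k) :=
  exists2 c : I -> Kz RR k, forall i, Vz (c i) & f = \sum_i c i * m i.

Section Vspan.
Context k (I : finType) (m : I -> Kz RR k).
Local Notation span := (Vspan m).

Lemma Vspan0 : span 0.
Proof.
by exists (fun _ => 0) => [i|]; [apply: Vz0 | rewrite big1 // => i _; rewrite mul0r].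
Qed.

Lemma VspanD f g : span f -> span g -> span (f + g).
Proof.
move=> [c Vc ->] [d Vd ->]; exists (fun i => c i + d i) => [i|].
  exact: VzD.
by rewrite -big_split; apply: eq_bigr => i _; rewrite mulrDl.
Qed.

Lemma VspanM v f : Vz v -> span f -> span (v * f).
Proof.
move=> Vv [c Vc ->]; exists (fun i => v * c i) => [i|]; first exact: VzM.
by rewrite mulr_sumr; apply: eq_bigr => i _; rewrite mulrA.
Qed.

Lemma VspanB f g : span f -> span g -> span (f - g).
Proof.
by move=> Sf Sg; apply: VspanD => //; rewrite -mulN1r; apply: VspanM => //; apply: VzN1.
Qed.

Lemma Vspan_gen i : span (m i).
Proof.
exists (fun j => if j == i then 1 else 0) => [j|].
  by case: ifP => _; [apply: Vz1 | apply: Vz0].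
rewrite (bigD1 i) //= eqxx mul1r big1 ?addr0 // => j /negPf ->.
by rewrite mul0r.
Qed.

Lemma Vspan_stable x :
  (forall i, span (x * m i)) -> forall f, span f -> span (x * f).
Proof.
move=> xm f [c Vc ->]; rewrite mulr_sumr; elim/big_ind: _ => [||i _].
- exact: Vspan0.
- exact: VspanD.
by rewrite mulrCA; apply: VspanM.
Qed.

(** Stability under the variables suffices: the inverse of z_i is the product of
    the other variables divided by the symmetric product of all of them. *)
Lemma Vspan_Lz : span 1 -> (forall i f, span f -> span (zvar RR i * f)) ->
  forall f, Lz f -> span f.
Proof.
move=> S1 Sz; have SzV i f : span f -> span ((zvar RR i)^-1 * f).
  move=> Sf; have -> : (zvar RR i)^-1 * f =
      (\prod_(j < k) zvar RR j)^-1 * (\prod_(j < k | j != i) zvar RR j * f).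
    rewrite (bigD1 i) //= invfM -mulrA mulKf //.
    by apply/prodf_neq0 => j _; apply: zvar_neq0.
  apply: VspanM; first exact: Vz_prod_zvarV.
  by elim/big_rec: _ => [|j p _ Sp]; rewrite ?mul1r // -mulrA; apply: Sz.
have SzX i d f : span f -> span (zvar RR i ^ d * f).
  move=> Sf; case: d => n; first rewrite -exprnP; last rewrite NegzE -exprnN -exprVn.
    by elim: n => [|n IH]; rewrite ?expr0 ?mul1r // exprS -mulrA; apply: Sz.
  by elim: n.+1 => [|p IH]; rewrite ?expr0 ?mul1r // exprS -mulrA; apply: SzV.
apply: Lz_ind => [||r d Rr]; [exact: Vspan0|exact: VspanD|].
apply: VspanM; first exact: Vz_scal.
by elim/big_rec: _ => // i p _ Sp; apply: SzX.
Qed.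

End Vspan.

(** Sym is linear over symmetric functions, so it carries spanning monomials to
    generators; the bound on the exponents is there to make these generators
    Laurent polynomials. *)
Section SpanGenerated.
Context k (I : finType) (e : I -> 'I_k -> nat).
Hypothesis e_lt : forall b i, (e b i < k)%N.
Hypothesis e_span : forall f, Lz f -> Vspan (fun b => monomial (e b)) f.

Lemma Vz_Symz_omegas g : Lz g -> Vz (Symz (g * omegas RR k)).
Proof.
move=> Lg; apply/VzE; split; last exact: symmetric_Symz.
have [N LN ->] := omegas_vdm k.
rewrite mulrA; have [c Vc ->] := e_span (LzM Lg LN).
rewrite mulr_suml Symz_sum; apply: Lz_sum => b _.
have [Lc Sc] := iffLR (VzE _) (Vc b).
rewrite -mulrA SymzM // Symz_monomial_vdm; apply: LzM => //.
exact: Lz_alternant.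
Qed.

Lemma ARk_generated :
  Vz_generated_by (@ARk RR k) (fun b => Symz (monomial (e b) * omegas RR k)).
Proof.
move=> P; split=> [/ARkE[_ [g Lg ->]]|[c Vc ->]].
  have [c Vc ->] := e_span Lg; exists c => //.
  rewrite mulr_suml Symz_sum; apply: eq_bigr => b _.
  by rewrite -mulrA SymzM //; have [] := iffLR (VzE _) (Vc b).
have [_ A0 AD AM] := @ARk_submodule RR k.
elim/big_ind: _ => // b _; apply: AM => //; apply/ARkE.
have Lm : Lz (monomial (e b)).
  by apply: Lz_prod => i _; apply: (Lz_zvarX _ _ (e b i)).
by split; [apply: Vz_Symz_omegas | exists (monomial (e b))].
Qed.
End SpanGenerated.
End Generation.

(** * Two and three variables *)

Section LowDegree.
Variable RR : realType.
Local Opaque omegas omega cross.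

Lemma shuffle_zpow k (g : Kz RR k) (d : int) :
  shuffle (Symz (g * omegas RR k)) (zpow RR d) =
  Symz (inl_ k 1 g * zvar RR (rshift k ord0) ^ d * omegas RR (k + 1)).
Proof.
rewrite -(Symz_omegas_small (zpow RR d)) // shuffle_omegas.
by rewrite [zpow _ _]/(zvar RR ord0 ^ d) fmorphXz /= rename_zvar.
Qed.

(* The default value of [nth] gives the remaining variables the exponent 0. *)
Definition exp2 (d : 'I_2) (i : 'I_2) : nat := nth 0%N [:: val d] i.

Definition exp3 (d : 'I_3 * 'I_2) (i : 'I_3) : nat :=
  nth 0%N [:: val d.1; val d.2] i.

Lemma sum2 (R : nmodType) (F : 'I_2 -> R) : \sum_i F i = F ord0 + F (lift ord0 ord0).
Proof. by rewrite big_ord_recl big_ord1. Qed.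

Lemma prod2 (R : pzRingType) (F : 'I_2 -> R) : \prod_i F i = F ord0 * F (lift ord0 ord0).
Proof. by rewrite big_ord_recl big_ord1. Qed.

Lemma sum3 (R : nmodType) (F : 'I_3 -> R) :
  \sum_i F i = F ord0 + F (lift ord0 ord0) + F (lift ord0 (lift ord0 ord0)).
Proof. by rewrite !big_ord_recl big_ord0 addr0 addrA. Qed.

Lemma prod3 (R : pzRingType) (F : 'I_3 -> R) :
  \prod_i F i = F ord0 * F (lift ord0 ord0) * F (lift ord0 (lift ord0 ord0)).
Proof. by rewrite !big_ord_recl big_ord0 mulr1 mulrA. Qed.

(** Expresses the second elementary symmetric function through a power sum and
    the product of the variables, hence as a visibly symmetric function. *)
Lemma e2_e3V (K : fieldType) (x y z : K) : x != 0 -> y != 0 -> z != 0 ->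
  x * y + x * z + y * z = x * y * z * (x^-1 + y^-1 + z^-1).
Proof. by move=> x0 y0 z0; field; rewrite x0 y0 z0. Qed.

Lemma monomial2 d : monomial RR (exp2 d) = zvar RR ord0 ^+ d.
Proof. by rewrite /monomial prod2 mulr1. Qed.

Lemma monomial3 d : monomial RR (exp3 d) =
  zvar RR ord0 ^+ d.1 * zvar RR (lift ord0 ord0) ^+ d.2.
Proof. by rewrite /monomial prod3 mulr1. Qed.

Lemma laurent_span2 (f : Kz RR 2) : Lz f -> Vspan (fun d => monomial RR (exp2 d)) f.
Proof.
set m := fun d => _.
pose x := zvar RR (ord0 : 'I_2); pose y := zvar RR (lift ord0 ord0 : 'I_2).
have m1 : Vspan m 1 by have := Vspan_gen m ord0; rewrite /m monomial2.
have mx : Vspan m x by have := Vspan_gen m ord_max; rewrite /m monomial2.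
have := Vz_power_sum RR 2 1; rewrite sum2 -/x -/y => Vp1.
have := Vz_prod_zvar RR 2; rewrite prod2 -/x -/y => Vp2.
have Sx g : Vspan m g -> Vspan m (x * g).
  apply: Vspan_stable => -[[|[|//]] di]; rewrite /m monomial2 -/x /=.
    by rewrite expr0 mulr1.
  (* x is a root of (T - x)(T - y). *)
  have -> : x * x ^+ 1 = (x + y) * x - x * y * 1 by ring.
  by apply: VspanB; apply: VspanM.
apply: Vspan_Lz => // i g Sg.
have [->|->] : i = ord0 \/ i = lift ord0 ord0.
- by case: i => [[|[|//]] ?]; [left|right]; apply: val_inj.
- exact: Sx.
(* Only the first variable remains to be treated, as x + y is symmetric. *)
have -> : zvar RR (lift ord0 ord0) * g = (x + y) * g - x * g by rewrite -/y; ring.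
by apply: VspanB; [apply: VspanM | apply: Sx].
Qed.

Lemma laurent_span3 (f : Kz RR 3) : Lz f -> Vspan (fun d => monomial RR (exp3 d)) f.
Proof.
set m := fun d => _.
pose x := zvar RR (ord0 : 'I_3); pose y := zvar RR (lift ord0 ord0 : 'I_3).
pose z := zvar RR (lift ord0 (lift ord0 ord0) : 'I_3).
have Sm a b (a3 : (a < 3)%N) (b2 : (b < 2)%N) : Vspan m (x ^+ a * y ^+ b).
  by have := Vspan_gen m (Ordinal a3, Ordinal b2); rewrite /m monomial3.
have := Vz_power_sum RR 3 1; rewrite sum3 -/x -/y -/z => Ve1.
have := Vz_prod_zvar RR 3; rewrite prod3 -/x -/y -/z => Ve3.
have Ve2 : Vz (x * y + x * z + y * z).
  have -> : x * y + x * z + y * z = x * y * z * (x^-1 + y^-1 + z^-1).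
    by apply: e2_e3V; apply: zvar_neq0.
  by apply: VzM => //; have := Vz_power_sum RR 3 (-1); rewrite sum3 !exprN1.
have Sx g : Vspan m g -> Vspan m (x * g).
  apply: Vspan_stable => -[[a a3] [b b2]]; rewrite /m monomial3 -/x -/y /=.
  have [a2|] := ltnP a 2; first by rewrite mulrA -exprS; apply: Sm.
  rewrite leq_eqVlt ltnNge -ltnS a3 orbF => /eqP ea; rewrite -{}ea.
  (* x is a root of (T - x)(T - y)(T - z). *)
  have -> : x * (x ^+ 2 * y ^+ b) = (x + y + z) * (x ^+ 2 * y ^+ b) -
      (x * y + x * z + y * z) * (x ^+ 1 * y ^+ b) + x * y * z * (x ^+ 0 * y ^+ b).
    by ring.
  by apply: VspanD; [apply: VspanB|]; apply: VspanM => //; apply: Sm.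
have SxX n g : Vspan m g -> Vspan m (x ^+ n * g).
  by move=> Sg; elim: n => [|n IH]; rewrite ?expr0 ?mul1r // exprS -mulrA; apply: Sx.
have Sy g : Vspan m g -> Vspan m (y * g).
  apply: Vspan_stable => -[[a a3] [[|[|//]] b2]]; rewrite /m monomial3 -/x -/y /=.
    by rewrite expr0 mulr1 mulrC; apply: (Sm a 1).
  (* y is a root of (T - y)(T - z), whose coefficients are polynomials in x over
     the symmetric functions. *)
  have -> : y * (x ^+ a * y ^+ 1) = x ^+ a *
      ((x + y + z) * (x ^+ 0 * y ^+ 1) + (x + y + z) * (x ^+ 1 * y ^+ 0)
       - (x * y + x * z + y * z) * (x ^+ 0 * y ^+ 0)
       - x ^+ 1 * y ^+ 1 - x ^+ 2 * y ^+ 0) by ring.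
  apply: SxX; do 2![apply: VspanB; last exact: Sm].
  by apply: VspanB; [apply: VspanD|]; apply: VspanM => //; apply: Sm.
apply: Vspan_Lz => [|i g Sg]; first by have := Sm 0%N 0%N isT isT; rewrite mulr1.
have [->|[->|->]] : i = ord0 \/ i = lift ord0 ord0 \/ i = lift ord0 (lift ord0 ord0).
- by case: i => [[|[|[|//]]] ?]; [left|right;left|right;right]; apply: val_inj.
- exact: Sx.
- exact: Sy.
have -> : zvar RR (lift ord0 (lift ord0 ord0)) * g =
  (x + y + z) * g - x * g - y * g by rewrite -/z; ring.
by apply: VspanB; [apply: VspanB; [apply: VspanM | apply: Sx] | apply: Sy].
Qed.

Lemma generator2 (d : 'I_2) : shuffle (zpow RR (Posz d)) (zpow RR 0) =
  Symz (monomial RR (exp2 d) * omegas RR 2).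
Proof.
rewrite -(Symz_omegas_small (zpow RR d)) // shuffle_zpow monomial2.
rewrite expr0z mulr1 [zpow _ _]/(zvar RR ord0 ^+ d) rmorphXn /= rename_zvar.
by congr (Symz (zvar RR _ ^+ d * _)); apply: val_inj.
Qed.

Lemma generator3 (d : 'I_3 * 'I_2) :
  shuffle (shuffle (zpow RR (Posz d.1)) (zpow RR (Posz d.2))) (zpow RR 0) =
  Symz (monomial RR (exp3 d) * omegas RR 3).
Proof.
rewrite -(Symz_omegas_small (zpow RR d.1)) // !shuffle_zpow monomial3.
rewrite expr0z mulr1 [zpow _ _]/(zvar RR ord0 ^+ d.1).
rewrite -exprnP rmorphM !rmorphXn /= !rename_zvar.
by congr (Symz (zvar RR _ ^+ d.1 * zvar RR _ ^+ d.2 * _)); apply: val_inj.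
Qed.

Lemma generated_by_ext k S (I : finType) (g h : I -> Kz RR k) :
  h =1 g -> Vz_generated_by S g -> Vz_generated_by S h.
Proof.
move=> hg Sg P; split=> [/Sg[c Vc ->]|[c Vc ->]].
  by exists c => //; apply: eq_bigr => i _; rewrite hg.
by apply/Sg; exists c => //; apply: eq_bigr => i _; rewrite hg.
Qed.
End LowDegree.

Theorem theorem1p1 (RR : realType) :
  [/\ forall k : nat, @Vz_submodule RR k (@ARk RR k),
      @Vz_generated_by RR 2 (@ARk RR 2) 'I_2
        (fun d : 'I_2 => shuffle (zpow RR (Posz d)) (zpow RR 0)) &
      @Vz_generated_by RR 3 (@ARk RR 3) ('I_3 * 'I_2)%type
        (fun d : 'I_3 * 'I_2 =>
           shuffle (shuffle (zpow RR (Posz d.1)) (zpow RR (Posz d.2)))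
                   (zpow RR 0))].
Proof.
split; first exact: ARk_submodule.
- apply: (generated_by_ext (@generator2 RR)).
  apply: ARk_generated => [d [[|[|//]] ?]|]; rewrite ?ltn_ord //.
  exact: laurent_span2.
apply: (generated_by_ext (@generator3 RR)).
apply: ARk_generated => [d [[|[|[|//]]] ?]|]; last exact: laurent_span3.
- exact: ltn_ord.
- exact: leq_trans (ltn_ord d.2) _.
by [].
Qed.
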